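(* Let $E$ be a complex Banach space, $0<\tau\le\infty$, $\alpha>0$, and let $A$ be the generator of an $\alpha$-times integrated cosine function $(C_\alpha(t))_{t\in[0,\tau)}$ on $E$. Then $$n(A)\le\left\lfloor\frac{\lceil\alpha\rceil+1}{2}\right\rfloor .$$
   Context: For a closed operator $A$ on $E$, $n(A):=\inf\{k\in\mathbb N_0:\ D(A^n)\subset\overline{D(A^{n+1})}\text{ for all }n\ge k\}$ (with $\inf\emptyset=\infty$), closures being taken in $E$; $A$ is called stationary dense if $n(A)<\infty$. An $\alpha$-times integrated cosine function with generator $A$ (a closed linear operator) is a strongly continuous family $(C_\alpha(t))_{t\in[0,\tau)}\subset L(E)$ such that $C_\alpha(t)A\subset AC_\alpha(t)$ for $t\in[0,\tau)$, and for all $x\in E$, $t\in[0,\tau)$: $\int_0^t(t-s)C_\alpha(s)x\,ds\in D(A)$ and $A\int_0^t(t-s)C_\alpha(s)x\,ds=C_\alpha(t)x-\frac{t^\alpha}{\Gamma(\alpha+1)}x$. (This is the $K$-convoluted $C$-cosine function with $C=I$ and $K(t)=t^{\alpha-1}/\Gamma(\alpha)$.) $\lfloor t\rfloor=\sup\{k\in\mathbb Z:k\le t\}$, $\lceil t\rceil=\inf\{k\in\mathbb Z:k\ge t\}$. *)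

(* Defs.v *)
From Stdlib Require Import Reals Lra.
From Coquelicot Require Import Coquelicot.
Set Implicit Arguments.
Unset Strict Implicit.
Open Scope R_scope.

(* Coquelicot integrates functions with values in normed modules over R only.
   [restrict_scalars E] is the complex Banach space E with the same addition,
   norm, topology and completeness, and with scalars restricted along [RtoC].
   Its carrier is convertible to that of E. *)
Section RestrictScalars.

Variable E : CompleteNormedModule C_AbsRing.

Definition scalR (r : R) (x : E) : E := scal (RtoC r) x.

Lemma scalR_assoc (r s : R) (x : E) : scalR r (scalR s x) = scalR (r * s) x.
Proof. unfold scalR. rewrite scal_assoc, RtoC_mult. reflexivity. Qed.

Lemma scalR_one (x : E) : scalR 1 x = x.
Proof. exact (scal_one x). Qed.

Lemma scalR_distr_l (r : R) (x y : E) :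
  scalR r (plus x y) = plus (scalR r x) (scalR r y).
Proof. exact (scal_distr_l (RtoC r) x y). Qed.

Lemma scalR_distr_r (r s : R) (x : E) :
  scalR (r + s) x = plus (scalR r x) (scalR s x).
Proof. unfold scalR. rewrite RtoC_plus. exact (scal_distr_r (RtoC r) _ x). Qed.

Lemma norm_scalR (r : R) (x : E) : norm (scalR r x) <= Rabs r * norm x.
Proof. rewrite <- Cmod_R. exact (norm_scal (RtoC r) x). Qed.

Definition restrict_ModuleSpace_class : ModuleSpace.class_of R_Ring E :=
  ModuleSpace.Class R_Ring E (AbelianGroup.class E)
    (ModuleSpace.Mixin R_Ring E scalR
       scalR_assoc scalR_one scalR_distr_l scalR_distr_r).

Definition restrict_NormedModuleAux_class :
    NormedModuleAux.class_of R_AbsRing E :=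
  NormedModuleAux.Class R_AbsRing E restrict_ModuleSpace_class
    (UniformSpace.class E).

Definition restrict_NormedModule_class : NormedModule.class_of R_AbsRing E :=
  NormedModule.Class R_AbsRing E restrict_NormedModuleAux_class
    (NormedModule.Mixin R_AbsRing
       (NormedModuleAux.Pack R_AbsRing E restrict_NormedModuleAux_class E)
       (@norm C_AbsRing E) (@norm_factor C_AbsRing E)
       (@norm_triangle C_AbsRing E) norm_scalR
       (@norm_compat1 C_AbsRing E) (@norm_compat2 C_AbsRing E)
       (@norm_eq_zero C_AbsRing E)).

Definition restrict_scalars : CompleteNormedModule R_AbsRing :=
  CompleteNormedModule.Pack R_AbsRing E
    (CompleteNormedModule.Class R_AbsRing E restrict_NormedModule_class
       (CompleteNormedModule.mixin C_AbsRing E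
          (CompleteNormedModule.class C_AbsRing E))) E.

End RestrictScalars.

Definition vint (E : CompleteNormedModule C_AbsRing) (f : R -> E) (a b : R) : E :=
  @RInt (restrict_scalars E) f a b.

(* A linear operator in E, not necessarily bounded or densely defined.  The
   values of [opval] outside [dom] carry no information. *)
Record operator (E : CompleteNormedModule C_AbsRing) := Operator {
  dom : E -> Prop;
  opval :> E -> E;
  dom_zero : dom zero;
  dom_plus : forall x y, dom x -> dom y -> dom (plus x y);
  dom_scal : forall (k : C) x, dom x -> dom (scal k x);
  op_plus : forall x y, dom x -> dom y ->
    opval (plus x y) = plus (opval x) (opval y);
  op_scal : forall (k : C) x, dom x -> opval (scal k x) = scal k (opval x)
}.

Definition closed_operator (E : CompleteNormedModule C_AbsRing)
    (A : operator E) : Prop :=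
  closed (fun p : E * E => dom A (fst p) /\ snd p = A (fst p)).

(* The domain of A^n. *)
Fixpoint pow_dom (E : CompleteNormedModule C_AbsRing) (A : operator E)
    (n : nat) (x : E) : Prop :=
  match n with
  | O => True
  | S m => dom A x /\ pow_dom A m (A x)
  end.

Definition closure (T : UniformSpace) (P : T -> Prop) (x : T) : Prop :=
  forall eps : posreal, exists y : T, ball x eps y /\ P y.

(* n(A), as an infimum in the extended reals; [Glb_Rbar] of the empty set is
   [p_infty]. *)
Definition stationarity_index (E : CompleteNormedModule C_AbsRing)
    (A : operator E) : Rbar :=
  Glb_Rbar (fun r : R => exists k : nat, r = INR k /\
    forall n : nat, (k <= n)%nat ->
      forall x : E, pow_dom A n x -> closure (pow_dom A (S n)) x).

Definition Gamma (z : R) : R :=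
  RInt_gen (fun t : R => Rpower t (z - 1) * exp (- t))
    (at_right 0) (Rbar_locally p_infty).

(* t^a for t >= 0 and a > 0.  [Rpower] cannot be used at t = 0, where
   [Rpower 0 a = 1]. *)
Definition pow_nonneg (t a : R) : R :=
  if Rlt_dec 0 t then Rpower t a else 0.

Definition in_range (tau : Rbar) (t : R) : Prop := 0 <= t /\ Rbar_lt t tau.

(* [Ct] is an [alpha]-times integrated cosine function on [0, tau) with
   generator [A].  Values of [Ct] outside [0, tau) are irrelevant. *)
Record integrated_cosine (E : CompleteNormedModule C_AbsRing) (alpha : R)
    (tau : Rbar) (A : operator E) (Ct : R -> E -> E) : Prop := {
  ic_closed : closed_operator A;
  ic_bounded : forall t, in_range tau t -> is_linear (Ct t);
  ic_strongly_continuous : forall (x : E) (t : R), in_range tau t ->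
    filterlim (fun s => Ct s x) (within (in_range tau) (locally t))
      (locally (Ct t x));
  ic_commute : forall (t : R) (x : E), in_range tau t -> dom A x ->
    dom A (Ct t x) /\ A (Ct t x) = Ct t (A x);
  ic_equation : forall (x : E) (t : R), in_range tau t ->
    let y := vint (fun s => scal (RtoC (t - s)) (Ct s x)) 0 t in
    dom A y /\
    A y = minus (Ct t x)
      (scal (RtoC (pow_nonneg t alpha / Gamma (alpha + 1))) x)
}.

(* Main.v *)
(* Let [conv] be convolution with [t], h_j its [j]-th iterate on
   t^alpha / Gamma(alpha + 1), and u_j its [j]-th iterate on t |-> C_alpha(t) x.
   Integrating the defining identity of C_alpha, by closedness of A, gives
   A u_{j+1}(t) = u_j(t) - h_j(t) x, so for x in D(A^n) the vector u_{n+1}(t)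
   lies in D(A^{n+1}).  For x in D(A), C_alpha(t) x = h_0(t) x + conv (C_alpha A x)(t);
   iterating this from C_alpha(t) x = o(1) gains two powers of t per step, so
   C_alpha(t) x = h_0(t) x + o(t^alpha) for x in D(A^k) as soon as alpha <= 2 k.
   As Gamma(alpha + 1) > 0, h_0 is positive for t > 0, and so the estimate
   survives convolution: u_{n+1}(t) / h_{n+1}(t) -> x as t -> 0.  The bound of the
   theorem is the least k with alpha <= 2 k. *)
Require Import Defs.
From Stdlib Require Import Reals ZArith Lra Lia Classical.
From Coquelicot Require Import Coquelicot.
Open Scope R_scope.

(** * Powers of [t] and positivity of the Gamma function *)

Lemma pow_nonneg_pos (t a : R) : 0 < t -> 0 < pow_nonneg t a.
Proof.
  intros Ht. unfold pow_nonneg. destruct (Rlt_dec 0 t); [apply exp_pos | lra].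
Qed.

Lemma pow_nonneg_nonpos (t a : R) : t <= 0 -> pow_nonneg t a = 0.
Proof. intros Ht. unfold pow_nonneg. destruct (Rlt_dec 0 t); lra. Qed.

Lemma Rpower_small (a eps : R) : 0 < a -> 0 < eps ->
  exists d : R, 0 < d /\ forall t, 0 < t <= d -> Rpower t a <= eps.
Proof.
  intros Ha Heps. exists (Rpower eps (/ a)). split; [apply exp_pos|].
  intros t Ht.
  replace eps with (Rpower (Rpower eps (/ a)) a).
  - apply Rle_Rpower_l; lra.
  - rewrite Rpower_mult, Rinv_l by lra. apply Rpower_1, Heps.
Qed.

Lemma continuous_pow_nonneg (a t : R) : 0 < a ->
  continuous (fun s => pow_nonneg s a) t.
Proof.
  intros Ha. destruct (Rtotal_order t 0) as [Ht | [-> | Ht]].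
  - apply continuous_ext_loc with (fun _ => 0).
    + exists (mkposreal (- t) ltac:(lra)). intros y Hy.
      unfold ball in Hy; simpl in Hy; unfold AbsRing_ball, abs, minus, plus, opp in Hy;
        simpl in Hy.
      apply Rabs_def2 in Hy. rewrite pow_nonneg_nonpos; [reflexivity | lra].
    + apply continuous_const.
  - intros P [eps HP].
    destruct (Rpower_small a (eps / 2) Ha) as (d & Hd & Hs).
    { destruct eps; simpl; lra. }
    exists (mkposreal d Hd). intros y Hy. apply HP.
    unfold ball in Hy |- *; simpl in Hy |- *;
      unfold AbsRing_ball, abs, minus, plus, opp in Hy |- *; simpl in Hy |- *.
    rewrite (pow_nonneg_nonpos 0) by lra. apply Rabs_def2 in Hy.
    unfold pow_nonneg. destruct (Rlt_dec 0 y) as [Hy0 | Hy0].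
    + specialize (Hs y ltac:(lra)). assert (0 < Rpower y a) by apply exp_pos.
      rewrite Rabs_right; destruct eps; simpl in *; lra.
    + rewrite Rabs_right; destruct eps; simpl in *; lra.
  - apply continuous_ext_loc with (fun s => exp (a * ln s)).
    + exists (mkposreal t Ht). intros y Hy.
      unfold ball in Hy; simpl in Hy; unfold AbsRing_ball, abs, minus, plus, opp in Hy;
        simpl in Hy.
      apply Rabs_def2 in Hy. unfold pow_nonneg. destruct (Rlt_dec 0 y); [reflexivity | lra].
    + apply (ex_derive_continuous (fun s => exp (a * ln s))). auto_derive. exact Ht.
Qed.

(* [ln y <= y - 1] at [y = t / (2 a)]. *)
Lemma pow_nonneg_le_exp (a t : R) : 0 < a ->
  pow_nonneg t a <= Rpower (2 * a) a * exp (t / 2).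
Proof.
  intros Ha. unfold pow_nonneg. destruct (Rlt_dec 0 t) as [Ht | Ht].
  - unfold Rpower. rewrite <- exp_plus.
    assert (H : a * ln t <= a * ln (2 * a) + t / 2).
    { assert (Hy : 0 < t / (2 * a)) by (apply Rdiv_lt_0_compat; lra).
      replace t with (2 * a * (t / (2 * a))) at 1 by (field; lra).
      rewrite ln_mult by lra.
      assert (ln (t / (2 * a)) <= t / (2 * a)).
      { rewrite <- (ln_exp (t / (2 * a))) at 2. apply Rlt_le, ln_increasing; [lra|].
        pose proof (exp_ineq1 (t / (2 * a)) ltac:(lra)). lra. }
      apply Rle_trans with (a * (ln (2 * a) + t / (2 * a))).
      - apply Rmult_le_compat_l; lra.
      - right. field. lra. }
    destruct H as [H | H]; [left; apply exp_increasing, H | right; now rewrite H].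
  - left. apply Rmult_lt_0_compat; apply exp_pos.
Qed.

(** [RInt_gen] carries information only once the integral is known to converge, so convergence comes
    first. The primitive [F] of the integrand, extended by 0 to t <= 0, is monotone and bounded; its
    supremum [L] is the improper integral, and L >= F 1 > 0. *)
Lemma Gamma_pos (a : R) : 0 < a -> 0 < Gamma (a + 1).
Proof.
  intros Ha.
  set (f := fun t => pow_nonneg t a * exp (- t)).
  set (F := fun b => RInt f 0 b).
  assert (Hf : forall t, continuous f t).
  { intros t. apply (continuous_mult (fun s => pow_nonneg s a) (fun s => exp (- s))).
    - apply continuous_pow_nonneg, Ha.
    - apply (ex_derive_continuous (fun s => exp (- s))). auto_derive. exact I. }
  assert (HI : forall u v, ex_RInt f u v).
  { intros u v. apply (@ex_RInt_continuous R_CompleteNormedModule). intros; apply Hf. }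
  assert (Hf0 : forall t, 0 <= f t).
  { intros t. unfold f, pow_nonneg. destruct (Rlt_dec 0 t).
    - left. apply Rmult_lt_0_compat; apply exp_pos.
    - lra. }
  assert (HFF : forall u v, RInt f u v = F v - F u).
  { intros u v. unfold F. rewrite <- (RInt_Chasles f 0 u v) by apply HI.
    unfold plus; simpl. lra. }
  assert (Hmono : forall u v, u <= v -> F u <= F v).
  { intros u v Huv. pose proof (RInt_ge_0 f u v Huv (HI u v) ltac:(auto)) as H.
    rewrite HFF in H. lra. }
  (* By [pow_nonneg_le_exp] the integrand is at most K exp (- t / 2), whose integral over [0, b]
     stays below 2 K. *)
  set (K := Rpower (2 * a) a). assert (HK : 0 < K) by apply exp_pos.
  assert (Hbound : forall b, 0 <= b -> F b <= 2 * K).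
  { intros b Hb.
    assert (HG : is_RInt (fun t => K * exp (- t / 2)) 0 b
               (minus (- 2 * K * exp (- b / 2)) (- 2 * K * exp (- 0 / 2)))).
    { apply (is_RInt_derive (fun t => - 2 * K * exp (- t / 2))).
      - intros s _. auto_derive; [exact I | unfold Rdiv; field].
      - intros t _. apply (ex_derive_continuous (fun t => K * exp (- t / 2))).
        auto_derive. exact I. }
    apply Rle_trans with (RInt (fun t => K * exp (- t / 2)) 0 b).
    - apply RInt_le; [exact Hb | apply HI | eexists; exact HG |].
      intros t _. unfold f.
      replace (- t / 2) with (t / 2 + - t) by field.
      rewrite exp_plus, <- Rmult_assoc. apply Rmult_le_compat_r.
      + left. apply exp_pos.
      + apply pow_nonneg_le_exp, Ha.
    - rewrite (is_RInt_unique _ _ _ _ HG). unfold minus, plus, opp; simpl.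
      replace (- 0 / 2) with 0 by field. rewrite exp_0.
      pose proof (exp_pos (- b / 2)). nra. }
  destruct (completeness (fun y => exists b, 0 <= b /\ y = F b)) as [L [HL1 HL2]].
  { exists (2 * K). intros y (b & Hb & ->). auto. }
  { exists (F 0), 0. split; [lra | reflexivity]. }
  assert (HL : forall b, 0 <= b -> F b <= L).
  { intros b Hb. apply HL1. exists b. auto. }
  assert (HF0 : F 0 = 0) by apply (RInt_point (V := R_CompleteNormedModule) 0 f).
  assert (Hint : is_RInt_gen (fun t => Rpower t (a + 1 - 1) * exp (- t))
                   (at_right 0) (Rbar_locally p_infty) L).
  { intros P [eps HP].
    assert (He : 0 < eps / 2) by (destruct eps; simpl; lra).
    assert (Hsup : exists b0, 0 <= b0 /\ L - eps / 2 < F b0).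
    { destruct (classic (exists b, 0 <= b /\ L - eps / 2 < F b)) as [H | Hno];
        [exact H|].
      exfalso. assert (L <= L - eps / 2); [|lra]. apply HL2. intros y (b & Hb & ->).
      apply Rnot_lt_le. intros Hlt. apply Hno. exists b. auto. }
    destruct Hsup as (b0 & Hb0 & HFb0).
    assert (HFc : continuous F 0).
    { apply (continuous_RInt_1 f 0 0 F). exists (mkposreal 1 Rlt_0_1). intros z _.
      apply (@RInt_correct R_CompleteNormedModule), HI. }
    specialize (HFc (ball (F 0) (eps / 2)) (locally_ball _ (mkposreal _ He))).
    destruct HFc as [d Hd].
    (* Both ends of the integral move: F v lies in (L - eps/2, L] for v > b0, and F u lies in [0,
       eps/2) for u > 0 near 0, so F v - F u is within eps of L. *)
    apply (Filter_prod (at_right 0) _ _ (fun u => 0 < u /\ Rabs (F u) < eps / 2) (fun v => b0 < v)).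
    - exists d. intros y Hy Hy0. split; [exact Hy0|]. specialize (Hd y Hy).
      unfold ball in Hd; simpl in Hd; unfold AbsRing_ball, abs, minus, plus, opp in Hd;
        simpl in Hd. rewrite HF0 in Hd. now replace (F y) with (F y + - 0) by ring.
    - exists b0. auto.
    - intros u v [Hu HFu] Hv. exists (RInt f u v). split.
      + simpl. apply is_RInt_ext with f; [|apply (@RInt_correct R_CompleteNormedModule), HI].
        intros t Ht. unfold f, pow_nonneg. destruct (Rlt_dec 0 t) as [H | H].
        * now replace (a + 1 - 1) with a by ring.
        * exfalso. apply H. unfold Rmin in Ht. destruct (Rle_dec u v); lra.
      + apply HP. unfold ball; simpl; unfold AbsRing_ball, abs, minus, plus, opp; simpl.
        rewrite HFF. pose proof (HL v ltac:(lra)). pose proof (Hmono b0 v ltac:(lra)).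
        pose proof (Hmono 0 u ltac:(lra)). apply Rabs_def2 in HFu. apply Rabs_def1; lra. }
  unfold Gamma.
  replace (RInt_gen _ _ _) with L.
  2: { symmetry. apply (@is_RInt_gen_unique R_CompleteNormedModule);
       [typeclasses eauto.. | exact Hint]. }
  apply Rlt_le_trans with (F 1); [|apply HL; lra].
  apply RInt_gt_0; [lra | | intros; apply Hf].
  intros t Ht. apply Rmult_lt_0_compat; [apply pow_nonneg_pos; lra | apply exp_pos].
Qed.

(** * Riemann integrals with values in a normed module *)

(** Riemann sums are linear combinations of values of [f], hence lie in [P], and a closed set keeps
    their limit. *)
Lemma is_RInt_subspace (V : NormedModule R_AbsRing) (P : V -> Prop)
    (hclosed : closed P) (hplus : forall x y, P x -> P y -> P (plus x y))
    (hscal : forall (k : R) x, P x -> P (scal k x))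
    (f : R -> V) (a b : R) (l : V) :
  a <= b -> (forall s, a <= s <= b -> P (f s)) -> is_RInt f a b l -> P l.
Proof.
  intros Hab Hf Hl.
  (* Clamping the argument puts every value of [g] in [P], so every Riemann sum of [g] lies in [P],
     wherever its tags are. *)
  set (g := fun s => f (Rmax a (Rmin s b))).
  assert (Hg : forall s, P (g s)).
  { intros s. apply Hf. split; [apply Rmax_l|]. apply Rmax_lub; [exact Hab | apply Rmin_r]. }
  assert (Hgl : is_RInt g a b l).
  { apply is_RInt_ext with (2 := Hl). rewrite Rmin_left, Rmax_right by exact Hab.
    intros s Hs. unfold g. now rewrite Rmin_left, Rmax_right by lra. }
  apply (closed_filterlim (F := Riemann_fine a b) _ P l Hgl); [|exact hclosed].
  intros ptd. apply hscal.
  induction ptd as [x0 | h ptd IH] using SF_cons_ind.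
  (* The empty sum is zero, which lies in [P] as 0 times a value of [g]. *)
  - exact (eq_ind _ P (hscal zero _ (Hg 0)) _ (scal_zero_l (g 0))).
  - rewrite Riemann_sum_cons. apply hplus; [apply hscal, Hg | exact IH].
Qed.

Lemma is_RInt_scal_vec (V : NormedModule R_AbsRing) (h : R -> R) (x : V) (a b l : R) :
  is_RInt h a b l -> is_RInt (fun s => scal (h s) x) a b (scal l x).
Proof.
  intros Hh. unfold is_RInt.
  apply filterlim_ext with (fun ptd => scal (scal (sign (b - a)) (Riemann_sum h ptd)) x).
  - intros ptd.
    transitivity (scal (sign (b - a)) (scal (Riemann_sum h ptd) x));
      [symmetry; apply scal_assoc | f_equal].
    induction ptd as [x0 | p ptd IH] using SF_cons_ind.
    + apply (scal_zero_l x).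
    + rewrite !Riemann_sum_cons, <- IH.
      etransitivity; [apply (scal_distr_r (K := R_Ring)) | f_equal].
      symmetry. apply (scal_assoc (SF_h ptd - fst p) (h (snd p)) x).
  - exact (filterlim_comp _ _ _ _ (fun r => scal r x) _ _ _ Hh (filterlim_scal_l l x)).
Qed.

(** * Convolution with [t] *)

(** For continuous [f] this is the twofold primitive of [f] vanishing to first order at 0. It serves
    both vector-valued functions and, with V = R, the scalar functions h_j. *)
Definition conv (V : CompleteNormedModule R_AbsRing) (f : R -> V) (t : R) : V :=
  RInt (fun s => scal (t - s) (f s)) 0 t.

Arguments conv {V}.

Lemma continuous_sub (t s : R) : continuous (fun r : R => t - r) s.
Proof. apply (ex_derive_continuous (fun r => t - r)). auto_derive. exact I. Qed.

Lemma is_RInt_conv (V : CompleteNormedModule R_AbsRing) (f : R -> V) (t : R) :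
  (forall s, continuous f s) ->
  is_RInt (fun s => scal (t - s) (f s)) 0 t (conv f t).
Proof.
  intros Hf. apply RInt_correct, ex_RInt_continuous. intros s _.
  apply (continuous_scal (fun s => t - s) f); [apply continuous_sub | apply Hf].
Qed.

Section Convolution.

Variable V : CompleteNormedModule R_AbsRing.

Lemma conv_eq (f : R -> V) (t : R) (l : V) :
  is_RInt (fun s => scal (t - s) (f s)) 0 t l -> conv f t = l.
Proof. apply is_RInt_unique. Qed.

Lemma conv_ext (f g : R -> V) (t : R) :
  0 <= t -> (forall s, 0 <= s <= t -> f s = g s) -> conv f t = conv g t.
Proof.
  intros Ht H. apply RInt_ext. rewrite Rmin_left, Rmax_right by lra.
  intros s Hs. now rewrite H by lra.
Qed.

(** The variable t occurs both in the kernel and as upper limit. Splitting t - s gives t times the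
    integral of f(s) minus the integral of s f(s), each continuous in its upper limit. *)
Lemma continuous_conv (f : R -> V) :
  (forall s, continuous f s) -> forall t, continuous (conv f) t.
Proof.
  intros Hf t.
  assert (H1 : forall u, is_RInt f 0 u (RInt f 0 u)).
  { intros u. apply RInt_correct, ex_RInt_continuous. intros; apply Hf. }
  assert (Hsf : forall t : R, continuous (fun s : R => scal s (f s)) t).
  { intros s. apply (continuous_scal (fun s : R => s) f); [apply continuous_id | apply Hf]. }
  assert (H2 : forall u,
            is_RInt (fun s : R => scal s (f s)) 0 u (RInt (fun s : R => scal s (f s)) 0 u)).
  { intros u. apply RInt_correct, ex_RInt_continuous. intros; apply Hsf. }
  apply continuous_ext with
    (fun u => minus (scal u (RInt f 0 u)) (RInt (fun s : R => scal s (f s)) 0 u)).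
  - intros u. symmetry. apply conv_eq.
    apply is_RInt_ext with (fun s => minus (scal u (f s)) (scal s (f s))).
    + intros s _. symmetry. unfold Rminus, minus.
      rewrite <- scal_opp_l. apply (scal_distr_r u (- s)).
    + apply (is_RInt_minus (fun s => scal u (f s))); [now apply (is_RInt_scal f) | apply H2].
  - apply (continuous_minus (fun u : R => scal u (RInt f 0 u))).
    + apply (continuous_scal (fun u : R => u) (fun u : R => RInt f 0 u)); [apply continuous_id|].
      apply (continuous_RInt_1 f 0 t). apply filter_forall, H1.
    + apply (continuous_RInt_1 (fun s : R => scal s (f s)) 0 t). apply filter_forall, H2.
Qed.

Lemma continuous_iter_conv (f : R -> V) (j : nat) :
  (forall s, continuous f s) -> forall t, continuous (Nat.iter j conv f) t.
Proof.
  intros Hf. induction j as [|j IH]; [exact Hf | apply continuous_conv, IH].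
Qed.

(* Applied to the graph of a closed operator, this is Hille's theorem. *)
Lemma conv_subspace (P : V * V -> Prop)
    (hclosed : closed P) (hplus : forall p q, P p -> P q -> P (plus p q))
    (hscal : forall (k : R) p, P p -> P (scal k p)) (f g : R -> V) (t : R) :
  (forall s, continuous f s) -> (forall s, continuous g s) -> 0 <= t ->
  (forall s, 0 <= s <= t -> P (f s, g s)) -> P (conv f t, conv g t).
Proof.
  intros Hf Hg Ht H.
  apply (is_RInt_subspace (prod_NormedModule R_AbsRing V V) P hclosed hplus hscal
           (fun s => scal (t - s) (f s, g s)) 0 t); [exact Ht | |].
  - intros s Hs. apply hscal, H, Hs.
  - apply (is_RInt_fct_extend_pair (fun s => scal (t - s) (f s, g s))); now apply is_RInt_conv.
Qed.

Lemma conv_minus_scal (f : R -> V) (h : R -> R) (x : V) (t : R) :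
  (forall s, continuous f s) -> (forall s, continuous h s) ->
  conv (fun s => minus (f s) (scal (h s) x)) t =
  minus (conv f t) (scal (@conv R_CompleteNormedModule h t) x).
Proof.
  intros Hf Hh. apply conv_eq.
  apply is_RInt_ext with (fun s => minus (scal (t - s) (f s)) (scal (scal (t - s) (h s)) x)).
  - intros s _. etransitivity; [|symmetry; apply (scal_minus_distr_l (t - s) (f s) (scal (h s) x))].
    f_equal. symmetry. apply (scal_assoc (t - s) (h s) x).
  - apply (is_RInt_minus (fun s => scal (t - s) (f s))); [now apply is_RInt_conv|].
    apply (is_RInt_scal_vec V (fun s => scal (t - s) (h s))).
    now apply (is_RInt_conv R_CompleteNormedModule).
Qed.

(** The kernel t - s is nonnegative on [0, t], so a pointwise bound by eps h is inherited by the
    convolutions with the same eps. *)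
Lemma norm_conv_le (f : R -> V) (h : R -> R) (eps t : R) :
  (forall s, continuous f s) -> (forall s, continuous h s) -> 0 <= t ->
  (forall s, 0 <= s <= t -> norm (f s) <= eps * h s) ->
  norm (conv f t) <= eps * @conv R_CompleteNormedModule h t.
Proof.
  intros Hf Hh Ht H.
  apply (norm_RInt_le (fun s => scal (t - s) (f s)) (fun s => eps * ((t - s) * h s)) 0 t).
  - exact Ht.
  - intros s Hs. apply Rle_trans with (1 := norm_scal (t - s) (f s)).
    change (abs (t - s)) with (Rabs (t - s)). rewrite Rabs_right by lra.
    replace (eps * ((t - s) * h s)) with ((t - s) * (eps * h s)) by ring.
    apply Rmult_le_compat_l; [lra | apply H, Hs].
  - now apply is_RInt_conv.
  - apply (is_RInt_scal (fun s => (t - s) * h s) 0 t eps).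
    now apply (is_RInt_conv R_CompleteNormedModule).
Qed.

(** The kernel is at most t on an interval of length t; this is where two powers of t are gained. *)
Lemma norm_conv_le_const (f : R -> V) (M t : R) :
  (forall s, continuous f s) -> 0 <= t ->
  (forall s, 0 <= s <= t -> norm (f s) <= M) -> norm (conv f t) <= M * t ^ 2.
Proof.
  intros Hf Ht H.
  replace (M * t ^ 2) with ((t - 0) * (t * M)) by ring.
  apply (norm_RInt_le_const (fun s => scal (t - s) (f s))); [exact Ht | |now apply is_RInt_conv].
  intros s Hs. apply Rle_trans with (1 := norm_scal (t - s) (f s)).
  change (abs (t - s)) with (Rabs (t - s)). rewrite Rabs_right by lra.
  apply Rmult_le_compat; [lra | apply norm_ge_0 | lra | apply H, Hs].
Qed.

End Convolution.

Lemma iter_conv_pos (h : R -> R) (j : nat) :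
  (forall s, continuous h s) -> (forall s, 0 < s -> 0 < h s) ->
  forall t, 0 < t -> 0 < Nat.iter j (@conv R_CompleteNormedModule) h t.
Proof.
  intros Hh Hpos. induction j as [|j IH]; [exact Hpos|].
  intros t Ht. apply RInt_gt_0; [exact Ht | |].
  - intros s Hs. apply Rmult_lt_0_compat; [lra | apply IH; lra].
  - intros s _.
    apply (continuous_scal (fun s => t - s) (Nat.iter j (@conv R_CompleteNormedModule) h));
      [apply continuous_sub|].
    apply (continuous_iter_conv R_CompleteNormedModule h j Hh).
Qed.

(** * Estimates o(t^r) at 0 *)

(** f(t) = o(t^r) as t -> 0+. The point t = 0 is left out, since [Rpower 0 r] is 1. *)
Definition little_o_power (V : NormedModule R_AbsRing) (f : R -> V) (r : R) : Prop :=
  forall eps, 0 < eps ->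
  exists d, 0 < d /\ forall t, 0 < t <= d -> norm (f t) <= eps * Rpower t r.

Section LittleO.

Variable V : CompleteNormedModule R_AbsRing.
Implicit Types f g : R -> V.

Lemma little_o_power_weaken f (r r' : R) :
  r' <= r -> little_o_power V f r -> little_o_power V f r'.
Proof.
  intros Hr Hf eps Heps. destruct (Hf eps Heps) as (d & Hd & H).
  exists (Rmin d 1). split; [apply Rmin_glb_lt; lra|].
  intros t [Ht Htd]. pose proof (Rmin_l d 1). pose proof (Rmin_r d 1).
  eapply Rle_trans; [apply H; lra|]. apply Rmult_le_compat_l; [lra|].
  replace r with (r' + (r - r')) by ring. rewrite Rpower_plus.
  rewrite <- (Rmult_1_r (Rpower t r')) at 2.
  apply Rmult_le_compat_l; [left; apply exp_pos|].
  (* Writing 1 as 1^(r - r') reduces t^(r - r') <= 1 to monotonicity in the base, with t <= 1. *)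
  rewrite <- (Rpower_O (R1)) by lra.
  replace (Rpower R1 0) with (Rpower 1 (r - r')).
  - apply Rle_Rpower_l; lra.
  - unfold Rpower. change R1 with 1. now rewrite ln_1, !Rmult_0_r.
Qed.

Lemma little_o_power_plus f g (r : R) :
  little_o_power V f r -> little_o_power V g r ->
  little_o_power V (fun t => plus (f t) (g t)) r.
Proof.
  intros Hf Hg eps Heps.
  destruct (Hf (eps / 2)) as (d & Hd & H); [lra|].
  destruct (Hg (eps / 2)) as (d' & Hd' & H'); [lra|].
  exists (Rmin d d'). split; [now apply Rmin_glb_lt|].
  intros t [Ht Htd]. pose proof (Rmin_l d d'). pose proof (Rmin_r d d').
  apply Rle_trans with (1 := norm_triangle (f t) (g t)).
  specialize (H t ltac:(lra)). specialize (H' t ltac:(lra)). lra.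
Qed.

Lemma little_o_power_ext f g (r T : R) : 0 < T ->
  (forall t, 0 <= t <= T -> f t = g t) -> little_o_power V f r -> little_o_power V g r.
Proof.
  intros HT Hfg Hf eps Heps. destruct (Hf eps Heps) as (d & Hd & H).
  exists (Rmin d T). split; [now apply Rmin_glb_lt|].
  intros t [Ht Htd]. pose proof (Rmin_l d T). pose proof (Rmin_r d T).
  rewrite <- Hfg by lra. apply H. lra.
Qed.

Lemma little_o_power_scal_pow (b c r : R) (x : V) : r < b ->
  little_o_power V (fun t => scal (pow_nonneg t b / c) x) r.
Proof.
  intros Hr eps Heps. set (K := Rabs (/ c) * norm x).
  assert (HK : 0 <= K) by (apply Rmult_le_pos; [apply Rabs_pos | apply norm_ge_0]).
  (* t^b = t^(b - r) t^r, and the first factor is made small; K + 1 replaces [K] because [K] may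
     vanish. *)
  destruct (Rpower_small (b - r) (eps / (K + 1))) as (d & Hd & H);
    [lra | apply Rdiv_lt_0_compat; lra|].
  exists d. split; [exact Hd|]. intros t Ht. specialize (H t Ht).
  apply Rle_trans with (1 := norm_scal (pow_nonneg t b / c) x).
  change (abs (pow_nonneg t b / c)) with (Rabs (pow_nonneg t b / c)). unfold Rdiv.
  rewrite Rabs_mult, Rmult_assoc. fold K.
  rewrite Rabs_right by (left; apply pow_nonneg_pos; lra).
  unfold pow_nonneg. destruct (Rlt_dec 0 t); [|lra].
  replace b with ((b - r) + r) by ring. rewrite Rpower_plus.
  assert (Hp : 0 < Rpower t r) by apply exp_pos.
  assert (Hp' : 0 < Rpower t (b - r)) by apply exp_pos.
  assert (Rpower t (b - r) * (K + 1) <= eps).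
  { apply Rmult_le_compat_r with (r := K + 1) in H; [|lra].
    replace (eps / (K + 1) * (K + 1)) with eps in H by (field; lra). exact H. }
  replace (Rpower t (b - r) * Rpower t r * K) with (Rpower t (b - r) * K * Rpower t r) by ring.
  apply Rmult_le_compat_r; lra.
Qed.

(** As r >= 0, the bound eps s^r on (0, t] is at most eps t^r, and [norm_conv_le_const] adds the
    factor t^2. The value at s = 0, which the little-o bound does not reach, is zero. *)
Lemma little_o_power_conv f (r : R) : 0 <= r -> f 0 = zero ->
  (forall s, continuous f s) -> little_o_power V f r -> little_o_power V (conv f) (r + 2).
Proof.
  intros Hr Hf0 Hfc Hf eps Heps. destruct (Hf eps Heps) as (d & Hd & H).
  exists d. split; [exact Hd|]. intros t Ht.
  replace (Rpower t (r + 2)) with (Rpower t r * t ^ 2).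
  2: { rewrite Rpower_plus. f_equal. change 2 with (INR 2). now rewrite Rpower_pow by lra. }
  rewrite <- Rmult_assoc. apply norm_conv_le_const; [exact Hfc | lra |].
  intros s [[Hs | <-] Hst].
  - eapply Rle_trans; [apply H; lra|]. apply Rmult_le_compat_l; [lra|].
    apply Rle_Rpower_l; lra.
  - rewrite Hf0. apply Rle_trans with 0; [right; apply (@norm_zero R_AbsRing V)|].
    apply Rmult_le_pos; [lra | left; apply exp_pos].
Qed.

Lemma little_o_power_0 f : f 0 = zero -> continuous f 0 -> little_o_power V f 0.
Proof.
  intros Hf0 Hf eps Heps.
  destruct (proj1 (filterlim_locally_ball_norm f _) Hf (mkposreal eps Heps)) as [d Hd].
  exists (d / 2). split; [destruct d; simpl; lra|].
  intros t Ht. rewrite Rpower_O, Rmult_1_r by lra.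
  left. rewrite Hf0 in Hd.
  replace (f t) with (minus (f t) zero) by apply minus_zero_r.
  apply Hd. unfold ball; simpl; unfold AbsRing_ball, abs, minus, plus, opp; simpl.
  rewrite Rabs_right; destruct d; simpl in *; lra.
Qed.

End LittleO.

(** * Auxiliary identities and the domains of powers of an operator *)

Lemma plus_minus_cancel (G : AbelianGroup) (x y : G) : plus y (minus x y) = x.
Proof.
  unfold minus. now rewrite (plus_comm x), plus_assoc, plus_opp_r, plus_zero_l.
Qed.

Lemma minus_plus_cancel (G : AbelianGroup) (x y : G) : minus (plus y x) y = x.
Proof.
  apply (plus_reg_l y). exact (plus_minus_cancel G (plus y x) y).
Qed.

(** Clamping to an interval is 1-Lipschitz; this makes the extension [U] below continuous. *)
Lemma Rabs_clamp_le (a b x y : R) : a <= b ->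
  Rabs (Rmax a (Rmin x b) - Rmax a (Rmin y b)) <= Rabs (x - y).
Proof.
  intros Hab. unfold Rmax, Rmin.
  repeat destruct (Rle_dec _ _); unfold Rabs; repeat destruct (Rcase_abs _); lra.
Qed.

Section PowDom.

Variables (E : CompleteNormedModule C_AbsRing) (A : operator E).

Lemma op_zero : A zero = zero.
Proof.
  transitivity (A (scal zero (zero : E))).
  - f_equal. symmetry. apply (scal_zero_l (zero : E)).
  - etransitivity; [exact (op_scal zero (dom_zero A))|]. apply (scal_zero_l (A zero)).
Qed.

Lemma pow_dom_plus (n : nat) (x y : E) :
  pow_dom A n x -> pow_dom A n y -> pow_dom A n (plus x y).
Proof.
  revert x y. induction n as [|n IH]; [easy|]. intros x y [Hx HAx] [Hy HAy].
  split; [now apply dom_plus | rewrite op_plus by easy; now apply IH].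
Qed.

Lemma pow_dom_scal (n : nat) (k : C) (x : E) :
  pow_dom A n x -> pow_dom A n (scal k x).
Proof.
  revert x. induction n as [|n IH]; [easy|]. intros x [Hx HAx].
  split; [now apply dom_scal | rewrite op_scal by easy; now apply IH].
Qed.

Lemma pow_dom_minus (n : nat) (x y : E) :
  pow_dom A n x -> pow_dom A n y -> pow_dom A n (minus x y).
Proof.
  intros Hx Hy. apply pow_dom_plus; [exact Hx|].
  exact (eq_ind _ (pow_dom A n) (pow_dom_scal n _ y Hy) _ (scal_opp_one y)).
Qed.

Lemma pow_dom_le (m n : nat) (x : E) : (m <= n)%nat -> pow_dom A n x -> pow_dom A m x.
Proof.
  revert n x. induction m as [|m IH]; intros n x Hmn; [easy|].
  destruct n as [|n]; [lia|]. intros [Hx HAx]. split; [exact Hx|].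
  apply (IH n); [lia | exact HAx].
Qed.

End PowDom.

(** * The integrated cosine function near 0 *)

Section IntegratedCosine.

Variables (E : CompleteNormedModule C_AbsRing) (tau : Rbar) (alpha : R).
Variables (A : operator E) (Ct : R -> E -> E).
Hypotheses (halpha : 0 < alpha) (hC : integrated_cosine alpha tau A Ct).
Variable T : R.
Hypotheses (hT : 0 < T) (hTtau : Rbar_lt T tau).

Let ER := restrict_scalars E.

(* [C_alpha] extended from [0, T] to a continuous function on the whole line. *)
Let U (x : ER) (s : R) : ER := Ct (Rmax 0 (Rmin s T)) x.

Let h (s : R) : R := pow_nonneg s alpha / Gamma (alpha + 1).

Lemma in_range_le (t : R) : 0 <= t <= T -> in_range tau t.
Proof.
  intros Ht. split; [lra|]. apply Rbar_le_lt_trans with T; [simpl; lra | exact hTtau].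
Qed.

Lemma clamp_in_range (s : R) : in_range tau (Rmax 0 (Rmin s T)).
Proof.
  apply in_range_le. split; [apply Rmax_l | apply Rmax_lub; [lra | apply Rmin_r]].
Qed.

Lemma cut_eq (x : ER) (t : R) : 0 <= t <= T -> U x t = Ct t x.
Proof. intros Ht. unfold U. rewrite (Rmin_left t T), (Rmax_right 0 t) by lra. reflexivity. Qed.

Lemma continuous_cut (x : ER) (s : R) : continuous (U x) s.
Proof.
  assert (Hclamp : filterlim (fun s => Rmax 0 (Rmin s T)) (locally s)
            (within (in_range tau) (locally (Rmax 0 (Rmin s T))))).
  { intros P [eps HP]. exists eps. intros y Hy.
    apply HP; [|apply clamp_in_range].
    unfold ball in Hy |- *; simpl in Hy |- *;
      unfold AbsRing_ball, abs, minus, plus, opp in Hy |- *; simpl in Hy |- *.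
    apply Rle_lt_trans with (2 := Hy). apply (Rabs_clamp_le 0 T). lra. }
  exact (filterlim_comp _ _ _ _ (fun s => Ct s x) _ _ _ Hclamp
           (@ic_strongly_continuous E alpha tau A Ct hC x _ (clamp_in_range s))).
Qed.

(** This is [ic_equation] on [0, T]: over [restrict_scalars E], [conv] is convertible to the
    integral [vint] there. *)
Lemma cut_graph (x : ER) (t : R) : 0 <= t <= T ->
  dom A (conv (U x) t) /\ A (conv (U x) t) = minus (U x t) (scal (h t) x).
Proof.
  intros Ht.
  rewrite (conv_ext ER (U x) (fun s => Ct s x));
    [| lra | intros s Hs; apply cut_eq; lra].
  rewrite cut_eq by exact Ht.
  exact (@ic_equation E alpha tau A Ct hC x t (in_range_le t Ht)).
Qed.

Lemma h_0 : h 0 = 0.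
Proof. unfold h. rewrite pow_nonneg_nonpos by lra. apply Rmult_0_l. Qed.

(** At t = 0 the integral and h both vanish, so the defining identity reads A 0 = C_alpha(0) x. *)
Lemma cut_0 (x : ER) : U x 0 = zero.
Proof.
  destruct (cut_graph x 0) as [_ H]; [lra|].
  replace (conv (U x) 0) with (zero : ER) in H by (symmetry; apply RInt_point).
  rewrite op_zero, h_0 in H.
  replace (scal 0 x) with (zero : ER) in H by (symmetry; apply (scal_zero_l x)).
  transitivity (minus (U x 0) zero); [symmetry; apply (minus_zero_r (U x 0)) | exact (eq_sym H)].
Qed.

Lemma continuous_h (s : R) : continuous h s.
Proof.
  apply (continuous_mult (fun s => pow_nonneg s alpha) (fun _ => / Gamma (alpha + 1))).
  - now apply continuous_pow_nonneg.
  - apply continuous_const.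
Qed.

Lemma h_pos (s : R) : 0 < s -> 0 < h s.
Proof.
  intros Hs. apply Rdiv_lt_0_compat; [now apply pow_nonneg_pos | now apply Gamma_pos].
Qed.

Let graph (p : ER * ER) : Prop := dom A (fst p) /\ snd p = A (fst p).

Lemma graph_plus (p q : ER * ER) : graph p -> graph q -> graph (plus p q).
Proof.
  intros [Hp Hp'] [Hq Hq']. split; [exact (dom_plus Hp Hq)|].
  change (plus (snd p) (snd q) = A (plus (fst p : E) (fst q))).
  rewrite (op_plus Hp Hq), Hp', Hq'. reflexivity.
Qed.

Lemma graph_scal (k : R) (p : ER * ER) : graph p -> graph (scal k p).
Proof.
  intros [Hp Hp']. split; [exact (dom_scal (RtoC k) Hp)|].
  change (scal k (snd p) = A (scal (RtoC k) (fst p : E))).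
  rewrite (op_scal (RtoC k) Hp), Hp'. reflexivity.
Qed.

Lemma conv_graph (f g : R -> ER) (t : R) :
  (forall s, continuous f s) -> (forall s, continuous g s) -> 0 <= t ->
  (forall s, 0 <= s <= t -> graph (f s, g s)) -> graph (conv f t, conv g t).
Proof.
  apply (conv_subspace ER graph (ic_closed hC) graph_plus graph_scal).
Qed.

(** A (conv (U x) t) is computed twice: by the defining identity, and by moving A under the
    integral, where it commutes with C_alpha(s). *)
Lemma cut_expansion (x : ER) (t : R) : dom A x -> 0 <= t <= T ->
  U x t = plus (scal (h t) x) (conv (U (A x)) t).
Proof.
  intros Hx Ht.
  destruct (conv_graph (U x) (U (A x)) t) as [_ H]; [apply continuous_cut.. | lra | |].
  - intros s Hs. destruct (ic_commute hC (clamp_in_range s) Hx) as [H1 H2].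
    split; [exact H1 | now symmetry].
  - simpl in H. rewrite H, (proj2 (cut_graph x t Ht)).
    symmetry. apply (plus_minus_cancel (restrict_scalars E) (U x t) (scal (h t) x)).
Qed.

(** For j = 0 this is the defining identity; convolving the identity for j with t, and passing the
    convolution through the closed graph, gives the one for j + 1. *)
Lemma iter_conv_graph (x : ER) (j : nat) (t : R) : 0 <= t <= T ->
  graph (Nat.iter (S j) conv (U x) t,
         minus (Nat.iter j conv (U x) t)
           (scal (Nat.iter j (@conv R_CompleteNormedModule) h t) x)).
Proof.
  revert t. induction j as [|j IH]; intros t Ht.
  - destruct (cut_graph x t Ht) as [H1 H2]. split; [exact H1 | now symmetry].
  - assert (HcU := continuous_iter_conv ER (U x) j (continuous_cut x)).
    assert (Hch := continuous_iter_conv R_CompleteNormedModule h j continuous_h).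
    change (graph (conv (Nat.iter (S j) conv (U x)) t,
      minus (conv (Nat.iter j conv (U x)) t)
        (scal (@conv R_CompleteNormedModule (Nat.iter j (@conv R_CompleteNormedModule) h) t) x))).
    rewrite <- (conv_minus_scal ER _ _ x t HcU Hch).
    apply conv_graph; [exact (continuous_iter_conv ER (U x) (S j) (continuous_cut x)) | | lra |].
    + intros s. apply (continuous_minus (Nat.iter j conv (U x))); [apply HcU|].
      apply (continuous_scal (Nat.iter j (@conv R_CompleteNormedModule) h) (fun _ => x));
        [apply Hch | apply continuous_const].
    + intros s Hs. apply IH. lra.
Qed.

(** A maps the iterate j + 1 to u_j - h_j x. Here u_j lies in D(A^j) by induction, and x does
    because j <= n; hence the last index reached is n + 1. *)
Lemma iter_conv_pow_dom (x : ER) (n j : nat) (t : R) :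
  pow_dom A n x -> (j <= S n)%nat -> 0 <= t <= T ->
  pow_dom A j (Nat.iter j conv (U x) t).
Proof.
  intros Hx Hj Ht. induction j as [|j IH]; [exact I|].
  destruct (iter_conv_graph x j t Ht) as [H1 H2]. split; [exact H1|].
  refine (eq_ind _ (pow_dom A j) _ _ H2).
  apply pow_dom_minus; [apply IH; lia|].
  apply (pow_dom_scal _ A j (RtoC _)), (pow_dom_le _ A j n); [lia | exact Hx].
Qed.

(** In [cut_expansion] the term h(t) x is o(t^r) because r < alpha, and the convolution gains two
    powers over the estimate for A x, which lies in D(A^k) in the induction step. *)
Lemma cut_little_o (k : nat) (x : ER) (r : R) :
  pow_dom A k x -> 0 <= r <= 2 * INR k -> r < alpha -> little_o_power ER (U x) r.
Proof.
  revert x r. induction k as [|k IH]; intros x r Hx Hr Hra.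
  - replace r with 0 by (simpl in Hr; lra).
    apply little_o_power_0; [apply cut_0 | apply continuous_cut].
  - destruct Hx as [Hx HAx].
    apply little_o_power_ext with (f := fun t => plus (scal (h t) x) (conv (U (A x)) t)) (T := T);
      [exact hT | intros t Ht; symmetry; now apply cut_expansion |].
    apply little_o_power_plus; [now apply little_o_power_scal_pow|].
    (* [little_o_power_conv] asks for a nonnegative exponent, so r - 2 is truncated at 0; the gain
       of 2 still reaches [r]. *)
    pose proof (Rmax_l 0 (r - 2)). pose proof (Rmax_r 0 (r - 2)).
    apply little_o_power_weaken with (r := Rmax 0 (r - 2) + 2); [lra|].
    rewrite S_INR in Hr. pose proof (pos_INR k).
    apply little_o_power_conv; [lra | apply cut_0 | apply continuous_cut|].
    apply IH; [exact HAx | |]; unfold Rmax in *; destruct (Rle_dec 0 (r - 2)); lra.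
Qed.

(** Once h(t) x is subtracted only conv (U (A x)) remains. [cut_little_o] applies to A x with
    exponent max(0, alpha - 2), strictly below alpha, so the endpoint exponent alpha is attained. *)
Lemma cut_remainder_little_o (k : nat) (x : ER) :
  pow_dom A k x -> alpha <= 2 * INR k ->
  little_o_power ER (fun t => minus (U x t) (scal (h t) x)) alpha.
Proof.
  intros Hx Hk. destruct k as [|k]; [simpl in Hk; lra|]. destruct Hx as [Hx HAx].
  apply little_o_power_ext with (f := conv (U (A x))) (T := T); [exact hT | |].
  - intros t Ht. rewrite (cut_expansion x t Hx Ht). symmetry.
    apply (minus_plus_cancel ER _ (scal (h t) x)).
  - pose proof (Rmax_l 0 (alpha - 2)). pose proof (Rmax_r 0 (alpha - 2)).
    rewrite S_INR in Hk. pose proof (pos_INR k).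
    apply little_o_power_weaken with (r := Rmax 0 (alpha - 2) + 2); [lra|].
    apply little_o_power_conv; [lra | apply cut_0 | apply continuous_cut|].
    apply cut_little_o with k; [exact HAx | |]; unfold Rmax in *;
      destruct (Rle_dec 0 (alpha - 2)); lra.
Qed.

(** * Density of D(A^(n+1)) in D(A^n) *)

Lemma pow_dom_closure (k n : nat) (x : E) :
  alpha <= 2 * INR k -> (k <= n)%nat -> pow_dom A n x -> closure (pow_dom A (S n)) x.
Proof.
  intros Hk Hkn Hx eps.
  set (e := eps / 2). assert (He : 0 < e) by (unfold e; destruct eps; simpl; lra).
  assert (HG := Gamma_pos alpha halpha).
  (* With this constant the bound in t^alpha becomes e h(t). *)
  destruct (cut_remainder_little_o k x (pow_dom_le _ A k n x Hkn Hx) Hk (e / Gamma (alpha + 1)))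
    as (d & Hd & H).
  { apply Rdiv_lt_0_compat; lra. }
  set (t := Rmin d T).
  assert (Ht : 0 < t <= T) by (split; [now apply Rmin_glb_lt | apply Rmin_r]).
  assert (Htd : t <= d) by apply Rmin_l.
  set (u := fun j => Nat.iter j conv (U x)).
  set (v := fun j => Nat.iter j (@conv R_CompleteNormedModule) h).
  (* The estimate is stated on all of [0, t], with 0 included, so that it can be integrated; the
     same e and t then serve every j. At s = 0 and j = 0 both sides vanish. *)
  assert (Hbound : forall j s, 0 <= s <= t ->
            norm (minus (u j s) (scal (v j s) (x : ER))) <= e * v j s).
  { intros j. induction j as [|j IH]; intros s Hs.
    - destruct (Req_dec s 0) as [-> | Hs0].
      + change (norm (minus (U x 0) (scal (h 0) (x : ER))) <= e * h 0).
        rewrite cut_0, h_0, Rmult_0_r. right.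
        transitivity (norm (zero : ER)); [f_equal | apply (@norm_zero R_AbsRing ER)].
        etransitivity; [|apply (minus_zero_r (zero : ER))].
        f_equal. apply (scal_zero_l (x : ER)).
      + eapply Rle_trans; [apply (H s); lra|]. right. unfold v, h, pow_nonneg; simpl.
        destruct (Rlt_dec 0 s); [field; lra | lra].
    - change (norm (minus (conv (u j) s) (scal (@conv R_CompleteNormedModule (v j) s) (x : ER)))
              <= e * @conv R_CompleteNormedModule (v j) s).
      assert (HcU := continuous_iter_conv ER (U x) j (continuous_cut x)).
      assert (Hch := continuous_iter_conv R_CompleteNormedModule h j continuous_h).
      rewrite <- (conv_minus_scal ER (u j) (v j) x s HcU Hch).
      apply norm_conv_le; [| exact Hch | lra |].
      + intros s'. apply (continuous_minus (u j)); [apply HcU|].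
        apply (continuous_scal (v j) (fun _ => (x : ER))); [apply Hch | apply continuous_const].
      + intros s' Hs'. apply IH. lra. }
  assert (Hv : 0 < v (S n) t) by (apply iter_conv_pos; [apply continuous_h | apply h_pos | lra]).
  (* Dividing the estimate for j = n + 1 by h_{n+1}(t) > 0 puts this vector within e < eps of
     [x]. *)
  exists (scal (/ v (S n) t) (u (S n) t)). split.
  - apply (@norm_compat1 R_AbsRing ER).
    set (w := minus (u (S n) t) (scal (v (S n) t) (x : ER))).
    apply Rle_lt_trans with (norm (scal (/ v (S n) t) w)).
    + right. f_equal. symmetry. unfold w.
      etransitivity; [apply (scal_minus_distr_l (/ v (S n) t) (u (S n) t))|]. f_equal.
      etransitivity; [apply (scal_assoc (/ v (S n) t) (v (S n) t) (x : ER))|].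
      replace (mult (/ v (S n) t) (v (S n) t)) with (one : R_Ring).
      * apply (scal_one (x : ER)).
      * symmetry. apply Rinv_l. lra.
    + apply Rle_lt_trans with (1 := norm_scal (/ v (S n) t) w).
      change (abs (/ v (S n) t)) with (Rabs (/ v (S n) t)).
      rewrite Rabs_right by (left; now apply Rinv_0_lt_compat).
      apply Rle_lt_trans with (/ v (S n) t * (e * v (S n) t)).
      * apply Rmult_le_compat_l; [left; now apply Rinv_0_lt_compat|]. apply Hbound. lra.
      * replace (/ v (S n) t * (e * v (S n) t)) with e by (field; lra).
        unfold e. destruct eps; simpl; lra.
  - apply (pow_dom_scal _ A (S n) (RtoC _)).
    apply (iter_conv_pow_dom x n (S n) t Hx); [lia | lra].
Qed.

End IntegratedCosine.

(** * The bound on the stationarity index *)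

Theorem proposition5 (E : CompleteNormedModule C_AbsRing) (tau : Rbar)
    (htau : Rbar_lt 0 tau) (alpha : R) (halpha : 0 < alpha)
    (A : operator E) (Ct : R -> E -> E)
    (hC : integrated_cosine alpha tau A Ct) :
  Rbar_le (stationarity_index A)
    (Finite (IZR (Zfloor ((IZR (Zceil alpha) + 1) / 2)))).
Proof.
  (* The argument is local at 0, so any finite T in (0, tau) serves, also when tau is infinite. *)
  assert (HT : exists T : R, 0 < T /\ Rbar_lt T tau).
  { destruct tau as [r | |]; simpl in htau; [| |easy].
    - exists (r / 2). simpl. lra.
    - exists 1. simpl. lra. }
  destruct HT as (T & HT & HTtau).
  set (z := Zfloor ((IZR (Zceil alpha) + 1) / 2)).
  assert (Hceil := Zceil_bound alpha).
  assert (Hz : alpha <= 2 * IZR z).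
  { (* [2 z > ceil alpha - 1] between integers. *)
    assert (Hfl : (IZR (Zceil alpha) + 1) / 2 < IZR z + 1) by apply Zfloor_bound.
    assert (Hlt : IZR (Zceil alpha) < IZR (2 * z + 1)) by (rewrite plus_IZR, mult_IZR; lra).
    apply lt_IZR in Hlt. assert (Hle : (Zceil alpha <= 2 * z)%Z) by lia.
    apply IZR_le in Hle. rewrite mult_IZR in Hle. lra. }
  assert (Hz0 : (0 <= z)%Z) by (apply le_IZR; lra).
  (* The infimum is a lower bound, so it is enough that z, nonnegative and thus a natural number,
     belongs to the set. *)
  apply (proj1 (Glb_Rbar_correct _)). exists (Z.to_nat z). split.
  - rewrite INR_IZR_INZ, Z2Nat.id by exact Hz0. reflexivity.
  - intros n Hn x. apply (pow_dom_closure E tau alpha A Ct halpha hC T HT HTtau (Z.to_nat z));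
      [|exact Hn].
    now rewrite INR_IZR_INZ, Z2Nat.id by exact Hz0.
Qed.
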